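(* For every positive integer $n$, $\mathrm{Aut}_c(\mathrm{UT}_n(\mathbb{Z})) = \mathrm{Inn}(\mathrm{UT}_n(\mathbb{Z}))$, where $\mathbb{Z}$ is the ring of integers.
   Context: $\mathrm{UT}_n(\mathbb{Z})$ is the group of all $n\times n$ lower unitriangular matrices (ones on the diagonal, zeros above it) with integer entries. For a group $G$, $\mathrm{Inn}(G)$ is the group of inner automorphisms of $G$. An automorphism $\alpha$ of $G$ is class preserving if $\alpha(x)$ is conjugate to $x$ in $G$ for every $x\in G$; $\mathrm{Aut}_c(G)$ is the group of all class preserving automorphisms of $G$. *)

(* Defs.v *)
From HB Require Import structures.
From mathcomp Require Import all_boot all_order all_algebra.
From mathcomp Require Import boolp classical_sets.

Set Implicit Arguments.
Unset Strict Implicit.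
Unset Printing Implicit Defensive.

Import GRing.Theory.
Local Open Scope ring_scope.

(* In MathComp, [is_trig_mx] means lower triangular: A i j = 0 when i < j. *)
Definition lower_unitriangular n (A : 'M[int]_n) : bool :=
  is_trig_mx A && [forall i, A i i == 1].

Record UT (n : nat) := MkUT {
  UTval :> 'M[int]_n;
  UTvalP : lower_unitriangular UTval
}.

HB.instance Definition _ n := [isSub for @UTval n].
HB.instance Definition _ n := [Choice of UT n by <:].

Section UTGroup.

Variable n : nat.
Implicit Types (A B : 'M[int]_n) (x y z : UT n).

Lemma lower_unitriangularP A :
  reflect ((forall i j : 'I_n, (i < j)%N -> A i j = 0) /\
           (forall i, A i i = 1))
          (lower_unitriangular A).
Proof.
apply: (iffP andP) => -[].
  by move=> /is_trig_mxP A0 /forallP A1; split=> // i; apply/eqP.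
move=> A0 A1; split; first exact/is_trig_mxP.
by apply/forallP=> i; apply/eqP.
Qed.

Lemma lower_unitriangular1 : lower_unitriangular (1%:M : 'M[int]_n).
Proof.
apply/lower_unitriangularP; split=> [i j ij|i]; rewrite mxE ?eqxx //.
by rewrite -val_eqE /= ltn_eqF.
Qed.

Lemma lower_unitriangularM A B :
  lower_unitriangular A -> lower_unitriangular B ->
  lower_unitriangular (A *m B).
Proof.
move=> /lower_unitriangularP[A0 A1] /lower_unitriangularP[B0 B1].
apply/lower_unitriangularP; split=> [i j ij|i].
  rewrite mxE big1 // => k _; case: (ltnP i k) => [/A0->|ki].
    by rewrite mul0r.
  by rewrite B0 ?mulr0 // (leq_ltn_trans ki).
rewrite mxE (bigD1 i) //= A1 B1 mulr1 big1 ?addr0 // => k ki.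
case: (ltngtP i k) => [/A0->|/B0->|ik]; rewrite ?mul0r ?mulr0 //.
by rewrite (val_inj ik) eqxx in ki.
Qed.

Lemma lower_unitriangular_unit A : lower_unitriangular A -> A \in unitmx.
Proof.
case/andP=> tA /forallP A1; rewrite unitmxE det_trig //.
by rewrite big1 ?unitr1 // => i _; apply/eqP.
Qed.

Lemma lower_unitriangularV A :
  lower_unitriangular A -> lower_unitriangular (invmx A).
Proof.
move=> utA; have uA := lower_unitriangular_unit utA.
case/lower_unitriangularP: utA => A0 A1.
have AV i j : \sum_k A i k * invmx A k j = (i == j)%:R.
  by have /matrixP/(_ i j) := mulmxV uA; rewrite !mxE.
have V0 m (i j : 'I_n) : (i < m)%N -> (i < j)%N -> invmx A i j = 0.
  elim: m i j => [//|m IHm] i j im ij.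
  have := AV i j; rewrite (bigD1 i) //= A1 mul1r big1 => [|k ki].
    by rewrite addr0 => ->; rewrite -val_eqE /= ltn_eqF.
  case: (ltngtP i k) => [/A0->|ki'|ik]; first by rewrite mul0r.
    by rewrite (IHm k j (leq_trans ki' im) (ltn_trans ki' ij)) mulr0.
  by rewrite (val_inj ik) eqxx in ki.
apply/lower_unitriangularP; split=> [i j|i]; first exact: (V0 n).
have := AV i i; rewrite (bigD1 i) //= A1 mul1r big1 ?addr0 ?eqxx // => k ki.
case: (ltngtP i k) => [/A0->|ki'|ik]; first by rewrite mul0r.
  by rewrite (V0 n) ?mulr0.
by rewrite (val_inj ik) eqxx in ki.
Qed.

Definition UTmul x y : UT n :=
  MkUT (lower_unitriangularM (UTvalP x) (UTvalP y)).
Definition UTone : UT n := MkUT lower_unitriangular1.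
Definition UTinv x : UT n := MkUT (lower_unitriangularV (UTvalP x)).

Lemma UTmulA : associative UTmul.
Proof. by move=> x y z; apply: val_inj; rewrite /= mulmxA. Qed.

Lemma UTmul1 : left_id UTone UTmul.
Proof. by move=> x; apply: val_inj; rewrite /= mul1mx. Qed.

Lemma UTmulr1 : right_id UTone UTmul.
Proof. by move=> x; apply: val_inj; rewrite /= mulmx1. Qed.

Lemma UTmulV : left_inverse UTone UTinv UTmul.
Proof.
move=> x; apply: val_inj.
by rewrite /= mulVmx ?(lower_unitriangular_unit (UTvalP x)).
Qed.

Lemma UTmulrV : right_inverse UTone UTinv UTmul.
Proof.
move=> x; apply: val_inj.
by rewrite /= mulmxV ?(lower_unitriangular_unit (UTvalP x)).
Qed.

HB.instance Definition _ :=
  isGroup.Build (UT n) UTmulA UTmul1 UTmulr1 UTmulV UTmulrV.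

End UTGroup.

Section Automorphisms.

Variable G : groupType.
Implicit Types (x y : G) (f : G -> G).

Definition automorphism f : Prop :=
  bijective f /\ {morph f : x y / (x * y)%g}.

Definition conjugate x y : Prop := exists g : G, y = (x ^ g)%g.

Definition class_preserving f : Prop := forall x, conjugate x (f x).

(* Aut_c(G) and Inn(G) are the underlying sets of these subgroups of Aut(G);
   two subgroups of Aut(G) are equal iff their underlying sets are. *)
Definition Aut_c : set (G -> G) :=
  [set f | automorphism f /\ class_preserving f]%classic.

Definition Inn : set (G -> G) :=
  [set f | exists g : G, f = (fun x => (x ^ g)%g)]%classic.

End Automorphisms.

Arguments Aut_c : clear implicits.
Arguments Inn : clear implicits.

(* Main.v *)
Require Import Defs.
From HB Require Import structures.
From mathcomp Require Import all_boot all_order all_algebra.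
From mathcomp Require Import boolp classical_sets.

(** The proof is by induction on the size, along the semidirect product
    decomposition UT (m+1) = Z^m x| UT m: splitting off the first row and the
    first column, a lower unitriangular matrix is [[1, 0], [v, A]], written
    (v, A), and (v, A) (w, B) = (v + A w, A B).

    Let f be a class preserving endomorphism of UT (m+1).  It maps the normal
    subgroup Z^m = {(v, 1)} into itself, so it induces a class preserving
    endomorphism of UT m, which is inner by induction; after a conjugation, f
    leaves the block A of every (v, A) unchanged.  Then f (v, 1) = (Z v, 1) for
    an integer matrix Z.  Since (Z v, 1) is conjugate to (v, 1), each Z v has
    the form B v with B in UT m depending on v; on the basis vectors this says
    that Z is itself lower unitriangular.  Multiplicativity of f makes Z central
    in UT m, so conjugation by (0, Z)^-1 undoes the action of f on Z^m without
    disturbing the blocks A.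

    What remains is f (v, A) = (v + delta A, A) with delta a 1-cocycle of UT m
    in Z^m, and such an f is conjugation by (w, 1) exactly when
    delta A = (A - 1) w for all A ([cocycle_inner]).  That (delta A, A) is
    conjugate to (0, A) gives this with a vector w depending on A, so all is
    reduced to a local-global principle for cocycles
    ([locally_principal_cocycle]).  That principle is again proved along
    UT (m+1) = Z^m x| UT m: on Z^m it amounts to the fact that an additive map
    having every vector as an eigenvector is a homothety ([eigen_additive]). *)

Set Implicit Arguments.
Unset Strict Implicit.
Unset Printing Implicit Defensive.

Import GRing.Theory.
Local Open Scope ring_scope.

(** * Additive maps between integer vectors *)

Definition additive_mx m k (f : 'cV[int]_m -> 'cV[int]_k) : 'M[int]_(k, m) :=
  \matrix_(i, j) f (delta_mx j 0) i 0.

(** Over the integers additivity already implies linearity. *)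
Lemma additive_mxE m k (f : 'cV[int]_m -> 'cV[int]_k) :
  {morph f : u v / u + v} -> forall v, f v = additive_mx f *m v.
Proof.
move=> fD v.
have f0 : f 0 = 0 by apply: (addrI (f 0)); rewrite -fD !addr0.
pose h : GRing.isNmodMorphism _ _ f :=
  GRing.isNmodMorphism.Build _ _ f (conj f0 fD).
pose F : {additive 'cV[int]_m -> 'cV[int]_k} := HB.pack f h.
rewrite -[f v]/(F v) {1}(matrix_sum_delta v) raddf_sum.
apply/colP => i; rewrite summxE mxE; apply: eq_bigr => j _.
rewrite big_ord1 -{1}[v j 0]intz scaler_int raddfMz -scaler_int intz !mxE.
by rewrite mulrC.
Qed.

(** The eigenvalue is the same for any two basis vectors, as their sum is an
    eigenvector too. *)
Lemma eigen_additive m (f : 'cV[int]_m -> 'cV[int]_m) :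
  {morph f : u v / u + v} -> (forall v, exists c, f v = c *: v) ->
  exists c, forall v, f v = c *: v.
Proof.
move=> fD feig.
have /choice[c cE] : forall j, exists c, f (delta_mx j 0) = c *: delta_mx j 0.
  by move=> j; apply: feig.
have cc i j : c i = c j.
  have [->//|ij] := eqVneq i j.
  have [d] := feig (delta_mx i 0 + delta_mx j 0); rewrite fD !cE => /colP cd.
  have := cd i; have := cd j.
  rewrite !mxE !eqxx [j == i]eq_sym (negPf ij) /=.
  by rewrite !(add0r, addr0, mulr0, mulr1) => -> ->.
case: m => [|m] in f fD feig c cE cc *.
  by exists 0 => v; rewrite [f v]flatmx0 [RHS]flatmx0.
exists (c 0) => v; rewrite (additive_mxE fD) -mul_scalar_mx; congr (_ *m _).
apply/matrixP => i j; rewrite mxE cE (cc j 0) !mxE !eqxx andbT.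
by rewrite mulr_natr.
Qed.

(** * The semidirect product decomposition *)

Section SemidirectProduct.

Variable m : nat.
Implicit Types (v w : 'cV[int]_m) (A B : UT m).

Lemma lower_unitriangular_block v A :
  lower_unitriangular (block_mx 1%:M 0 v (UTval A) : 'M_(1 + m)).
Proof.
have /andP[At /forallP A1] := UTvalP A.
apply/andP; split.
  rewrite (@is_trig_block_mx _ 1 m 1 m) // eqxx At andbT /=.
  by apply/is_trig_mxP => i j; rewrite !ord1.
apply/forallP => i; case: (@split_ordP 1 m i) => j ->.
  by rewrite (@block_mxEul _ 1 m 1 m) mxE eqxx.
by rewrite (@block_mxEdr _ 1 m 1 m).
Qed.

Definition UTpair v A : UT m.+1 := MkUT (lower_unitriangular_block v A).

Lemma UTpair_surj (x : UT m.+1) : exists v A, x = UTpair v A.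
Proof.
case: x => x xut; have /lower_unitriangularP[x0 x1] := xut.
have Aut : lower_unitriangular (@drsubmx _ 1 m 1 m x).
  apply/lower_unitriangularP; split=> [i j ij|i]; rewrite !mxE ?x1 //.
  by apply: x0; rewrite /= ltn_add2l.
exists (@dlsubmx _ 1 m 1 m x), (MkUT Aut); apply: val_inj => /=.
have ul1 : @ulsubmx _ 1 m 1 m x = 1%:M.
  apply/matrixP => i j; rewrite !ord1 !mxE -[RHS](x1 0).
  by congr (x _ _); apply: val_inj.
have ur0 : @ursubmx _ 1 m 1 m x = 0.
  by apply/matrixP => i j; rewrite !mxE x0 //= ord1.
by rewrite -ul1 -ur0 (@submxK _ 1 m 1 m).
Qed.

Lemma UTpair_inj v A w B : UTpair v A = UTpair w B -> v = w /\ A = B.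
Proof.
move=> /(congr1 (@UTval _)) /(@eq_block_mx _ 1 m 1 m)[_ _ -> AB].
by split=> //; apply: val_inj.
Qed.

Lemma UTpairM v A w B :
  (UTpair v A * UTpair w B)%g = UTpair (v + UTval A *m w) (A * B)%g.
Proof.
apply: val_inj => /=; rewrite (@mulmx_block _ 1 m 1 m 1 m).
by rewrite !mulmx1 !mul1mx !mulmx0 !mul0mx !addr0 !add0r.
Qed.

Lemma UTpair_conj v A w B :
  (UTpair v A ^ UTpair w B)%g =
  UTpair (UTval B^-1%g *m (v + UTval A *m w - w)) (A ^ B)%g.
Proof.
apply: (@mulgI _ (UTpair w B)); rewrite -conjgC !UTpairM mulmxA.
have -> : UTval B *m UTval B^-1%g = 1%:M.
  by have /(congr1 (@UTval _)) := mulgV B.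
by rewrite mul1mx [w + _]addrC subrK -conjgC.
Qed.

Lemma UTpair_split v A : UTpair v A = (UTpair v 1 * UTpair 0 A)%g.
Proof. by rewrite UTpairM mulmx0 addr0 mul1g. Qed.

End SemidirectProduct.

(** * Locally principal cocycles *)

(** The restriction of delta to UT m is principal by induction, say given by w,
    and its restriction to the vectors (u, 1) is u |-> c u.  The first
    coordinate of a vector only matters to the action of the (u, 1), so that
    (c, w) works for both factors at once. *)
Lemma locally_principal_cocycle m (delta : UT m -> 'cV[int]_m) :
  (forall A B, delta (A * B)%g = delta A + UTval A *m delta B) ->
  (forall A, exists w, delta A = UTval A *m w - w) ->
  exists w, forall A, delta A = UTval A *m w - w.
Proof.
elim: m delta => [|m IHm] delta deltaM deltaP.
  by exists 0 => A; rewrite [LHS]flatmx0 [RHS]flatmx0.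
have blockP (u : 'cV_m) A (w : 'cV_(1 + m)) :
    UTval (UTpair u A) *m w - w =
    col_mx 0 (u *m usubmx w + (UTval A *m dsubmx w - dsubmx w)) :> 'cV_(1 + m).
  rewrite -{1 2}[w](@vsubmxK _ 1 m 1) /= (@mul_block_col _ 1 m 1 m 1).
  rewrite (@opp_col_mx _ 1 m 1) (@add_col_mx _ 1 m 1) mul1mx.
  by rewrite mul0mx addr0 subrr addrA.
pose d x : 'cV_m := @dsubmx _ 1 m 1 (delta x).
have deltaE x : delta x = @col_mx _ 1 m 1 0 (d x).
  have [u [A xE]] := UTpair_surj x; have [w wE] := deltaP x.
  by rewrite /d wE xE blockP (@col_mxKd _ 1 m 1).
have dM u A y : d (UTpair u A * y)%g = d (UTpair u A) + UTval A *m d y.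
  rewrite {1}/d deltaM [delta y]deltaE [delta (UTpair _ _)]deltaE /=.
  rewrite (@mul_block_col _ 1 m 1 m 1) (@add_col_mx _ 1 m 1) (@col_mxKd _ 1 m 1).
  by rewrite mulmx0 add0r.
have dP u A : exists w : 'cV_(1 + m),
    d (UTpair u A) = u *m usubmx w + (UTval A *m dsubmx w - dsubmx w).
  have [w wE] := deltaP (UTpair u A); exists w.
  by rewrite /d wE blockP (@col_mxKd _ 1 m 1).
have [w wE] : exists w, forall A, d (UTpair 0 A) = UTval A *m w - w.
  apply: IHm => [A B|A]; first by rewrite -dM UTpairM mulmx0 addr0.
  by have [w ->] := dP 0 A; exists (dsubmx w); rewrite mul0mx add0r.
have [c cE] : exists c, forall u, d (UTpair u 1%g) = c *: u.
  apply: eigen_additive => [u v|u].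
    by rewrite -[d (UTpair v _)]mul1mx -dM UTpairM mul1mx mulg1.
  have [z ->] := dP u 1%g; exists (usubmx z 0 0).
  rewrite mul1mx subrr addr0.
  by rewrite {1}[usubmx z]mx11_scalar mul_mx_scalar.
exists (@col_mx _ 1 m 1 c%:M w) => x; have [u [A ->]] := UTpair_surj x.
rewrite deltaE blockP (@col_mxKu _ 1 m 1) (@col_mxKd _ 1 m 1) mul_mx_scalar.
by rewrite UTpair_split dM cE wE mul1mx.
Qed.

(** * Class preserving endomorphisms *)

Lemma class_preserving_conj (G : groupType) (f : G -> G) (g : G) :
  {morph f : x y / (x * y)%g} -> class_preserving f ->
  {morph (fun x => f x ^ g)%g : x y / (x * y)%g} /\
  class_preserving (fun x => f x ^ g)%g.
Proof.
move=> fM fc; split=> [x y|x]; first by rewrite fM conjMg.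
by have [h ->] := fc x; exists (h * g)%g; rewrite conjgM.
Qed.

(** The last normal form of the reduction: f is trivial on the abelian normal
    subgroup and on the quotient by it, and only the cocycle delta defined by
    f (0, A) = (delta A, A) is left to kill. *)
Lemma cocycle_inner m (f : UT m.+1 -> UT m.+1) :
  {morph f : x y / (x * y)%g} -> class_preserving f ->
  (forall v A, exists w, f (UTpair v A) = UTpair w A) ->
  (forall v, f (UTpair v 1%g) = UTpair v 1%g) ->
  exists g, forall x, f x = (x ^ g)%g.
Proof.
move=> fM fc fA fV.
have /choice[delta deltaE] : forall A, exists w, f (UTpair 0 A) = UTpair w A.
  by move=> A; apply: fA.
have [A B|A|w wE] := @locally_principal_cocycle m delta.
- have := fM (UTpair 0 A) (UTpair 0 B).
  by rewrite UTpairM mulmx0 addr0 !deltaE UTpairM => /UTpair_inj[].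
- have [g] := fc (UTpair 0 A); have [w [B ->]] := UTpair_surj g.
  rewrite deltaE UTpair_conj add0r => /UTpair_inj[-> AE].
  exists (UTval B^-1%g *m w); rewrite mulmxBr !mulmxA; congr (_ *m _ - _).
  (* B commutes with A, hence so does its inverse. *)
  have : (B^-1 * A = A * B^-1)%g.
    by apply: (@mulgI _ B); rewrite mulVKg mulgA [in RHS]AE -conjgC mulgK.
  by move=> /(congr1 (@UTval _)).
exists (UTpair w 1%g) => x; have [v [A ->]] := UTpair_surj x.
rewrite UTpair_conj conjg1 invg1 mul1mx UTpair_split fM fV deltaE UTpairM.
by rewrite mul1mx mul1g wE addrA.
Qed.

(** The matrix Z of f on the abelian normal subgroup is lower unitriangular
    because its j-th column is B e_j for some B in UT m, and central because
    f is multiplicative. *)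
Lemma unipotent_part_inner m (f : UT m.+1 -> UT m.+1) :
  {morph f : x y / (x * y)%g} -> class_preserving f ->
  (forall v A, exists w, f (UTpair v A) = UTpair w A) ->
  exists g, forall x, f x = (x ^ g)%g.
Proof.
move=> fM fc fA.
have /choice[phi phiE] : forall v, exists w, f (UTpair v 1%g) = UTpair w 1%g.
  by move=> v; apply: fA.
have phiD : {morph phi : u v / u + v}.
  move=> u v; have := fM (UTpair u 1%g) (UTpair v 1%g).
  by rewrite !phiE !UTpairM !mul1mx mulg1 phiE => /UTpair_inj[].
have phiP v : exists B : UT m, phi v = UTval B *m v.
  have [g] := fc (UTpair v 1%g); have [w [B ->]] := UTpair_surj g.
  rewrite phiE UTpair_conj mul1mx addrK => /UTpair_inj[-> _].
  by exists B^-1%g.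
have phi_equivar (A : UT m) v : phi (UTval A *m v) = UTval A *m phi v.
  have [d dE] := fA 0 A.
  have : (UTpair 0 A * UTpair v 1 = UTpair (UTval A *m v) 1 * UTpair 0 A)%g.
    by rewrite !UTpairM mulmx0 addr0 add0r mul1g mulg1.
  move=> /(congr1 f); rewrite !fM !phiE dE !UTpairM mul1mx => /UTpair_inj[].
  by rewrite addrC => /addIr ->.
have phiZ := additive_mxE phiD; set Z := additive_mx phi in phiZ.
have Zcol j : exists B : UT m, forall i, Z i j = UTval B i j.
  have [B BE] := phiP (delta_mx j 0); exists B => i.
  by rewrite mxE BE -colE mxE.
have Zut : lower_unitriangular Z.
  apply/lower_unitriangularP; split=> [i j ij|i].
    by have [B ->] := Zcol j; have /lower_unitriangularP[->] := UTvalP B.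
  by have [B ->] := Zcol i; have /lower_unitriangularP[_ ->] := UTvalP B.
pose z : UT m := MkUT Zut.
have zC A : (A ^ z = A)%g.
  apply: (@mulgI _ z); rewrite -conjgC; apply: val_inj => /=.
  apply/matrixP => i j; have := phi_equivar A (delta_mx j 0).
  by rewrite !phiZ !mulmxA -!colE => /colP/(_ i); rewrite !mxE.
have [f'M f'c] := class_preserving_conj (UTpair 0 z) fM fc.
have [v A|v|g gE] := cocycle_inner f'M f'c.
- have [w ->] := fA v A; exists (UTval z^-1%g *m w).
  by rewrite UTpair_conj mulmx0 addr0 subr0 zC.
- rewrite phiE phiZ UTpair_conj mulmx0 addr0 subr0 zC mulmxA.
  have -> : UTval z^-1%g *m Z = 1%:M by have /(congr1 (@UTval _)) := mulVg z.
  by rewrite mul1mx.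
exists (g * (UTpair 0 z)^-1)%g => x.
by rewrite conjgM -gE conjgK.
Qed.

(** Stated for endomorphisms, so that the induction does not have to show that
    the map q induced on the quotient UT m is bijective. *)
Lemma class_preserving_inner n (f : UT n -> UT n) :
  {morph f : x y / (x * y)%g} -> class_preserving f ->
  exists g, forall x, f x = (x ^ g)%g.
Proof.
elim: n f => [|m IHm] f fM fc.
  by exists 1%g => x; apply: val_inj; rewrite [LHS]flatmx0 [RHS]flatmx0.
have fV v : exists w, f (UTpair v 1%g) = UTpair w 1%g.
  have [g ->] := fc (UTpair v 1%g); have [w [B ->]] := UTpair_surj g.
  by rewrite UTpair_conj conj1g; eexists.
have /choice[q qE] : forall A, exists B, exists w, f (UTpair 0 A) = UTpair w B.
  by move=> A; have [w [B ->]] := UTpair_surj (f (UTpair 0 A)); exists B, w.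
have [A B|A|h hE] := IHm q.
- have [u uE] := qE A; have [v vE] := qE B; have [w wE] := qE (A * B)%g.
  have := fM (UTpair 0 A) (UTpair 0 B).
  by rewrite UTpairM mulmx0 addr0 uE vE wE UTpairM => /UTpair_inj[].
- have [u uE] := qE A; have [g] := fc (UTpair 0 A).
  have [w [B ->]] := UTpair_surj g.
  by rewrite uE UTpair_conj => /UTpair_inj[_ ->]; exists B.
have [f'M f'c] := class_preserving_conj (UTpair 0 h^-1%g) fM fc.
have [v A|g gE] := unipotent_part_inner f'M f'c.
  have [w wE] := fV v; have [u uE] := qE A.
  rewrite UTpair_split fM wE uE UTpairM UTpair_conj mul1g hE conjgK.
  by eexists.
exists (g * (UTpair 0 h^-1)^-1)%g => x.
by rewrite conjgM -gE conjgK.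
Qed.

Theorem theorem2 (n : nat) (hn : (0 < n)%N) : Aut_c (UT n) = Inn (UT n).
Proof.
apply/seteqP; split=> f /= [].
  by move=> [_ fM] /(class_preserving_inner fM)[g gE]; exists g; apply/funext.
move=> g ->; split=> [|x]; last by exists g.
split; last by move=> x y; rewrite conjMg.
by exists (fun x => x ^ g^-1)%g => x; rewrite ?conjgK ?conjgKV.
Qed.
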